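(* Let $C\subseteq\mathbb{R}^n$ be a nonempty closed convex set and $D\subseteq\mathbb{R}^n$ a nonempty closed set, and suppose that either $C$ or $D$ is compact. Suppose in addition that $0<\gamma<\sqrt{\frac32}-1$. Let $\{(y^t,z^t,x^t)\}_{t\ge1}$ be any sequence generated by the Douglas-Rachford splitting method for the feasibility problem (defined in the context) with step-size parameter $\gamma$ from an initial point $x^0\in\mathbb{R}^n$. Then the sequence $\{(y^t,z^t,x^t)\}$ is bounded, and any cluster point $(y^*,z^*,x^* )$ of the sequence satisfies $z^*=y^*$, and $z^*$ is a stationary point of the problem $\min_{u\in D}\frac12d_C^2(u)$. Moreover, $$\lim_{t\to\infty}\|x^{t+1}-x^t\|=\lim_{t\to\infty}\|z^{t+1}-y^{t+1}\|=0 .$$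
   Context: $d_C(u)=\inf_{c\in C}\|u-c\|$ and $P_C$ is the projection onto the closed convex set $C$. Douglas-Rachford splitting method for the feasibility problem. Given $x^0\in\mathbb{R}^n$ and $\gamma>0$, for $t=0,1,2,\dots$ set/choose $$y^{t+1}=\frac1{1+\gamma}\big(x^t+\gamma P_C(x^t)\big),\quad z^{t+1}\in\operatorname{Arg\,min}_{z\in D}\|2y^{t+1}-x^t-z\|^2,\quad x^{t+1}=x^t+(z^{t+1}-y^{t+1}).$$ Stationarity. A point $z^*\in D$ is a stationary point of $\min_{u\in D}\frac12d_C^2(u)$ if $0\in z^*-P_C(z^* )+N_D(z^* )$ (note $\nabla(\frac12d_C^2)(u)=u-P_C(u)$). Here $N_D(x)=\partial\delta_D(x)$ is the limiting normal cone of $D$ at $x\in D$, where $\delta_D$ is the indicator function of $D$ ($0$ on $D$, $+\infty$ elsewhere) and $\partial$ is the limiting subdifferential; equivalently, $v\in N_D(x)$ iff there exist $x^k\in D$, $x^k\to x$, $v^k\to v$ with $\limsup_{z\to x^k,\,z\in D,\,z\ne x^k}\frac{\langle v^k,z-x^k\rangle}{\|z-x^k\|}\le0$ for each $k$. *)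

(* Defs.v *)
From mathcomp Require Import all_boot all_order all_algebra.
From mathcomp Require Import all_classical all_reals all_analysis.

Set Implicit Arguments.
Unset Strict Implicit.
Unset Printing Implicit Defensive.

Import Order.TTheory GRing.Theory Num.Theory.
Import numFieldNormedType.Exports.

Local Open Scope classical_set_scope.
Local Open Scope ring_scope.

(** R^n is ['rV[R]_n].  The library norm [`|u|] on row vectors is the max norm:
    it is used only for the topology and for boundedness, which do not depend
    on the norm.  All metric notions below use the Euclidean norm [enorm]. *)

Definition dotv {R : realType} {n : nat} (u v : 'rV[R]_n) : R :=
  \sum_(i < n) u ord0 i * v ord0 i.

Definition enorm {R : realType} {n : nat} (u : 'rV[R]_n) : R :=
  Num.sqrt (dotv u u).

Definition dist {R : realType} {n : nat} (C : set 'rV[R]_n) (u : 'rV[R]_n) : R :=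
  inf [set enorm (u - c) | c in C].

(** The default value 0 is only taken when the distance is not attained, which
    does not happen when [C] is nonempty and closed. *)
Definition proj {R : realType} {n : nat} (C : set 'rV[R]_n) (u : 'rV[R]_n) :
    'rV[R]_n :=
  xget 0 [set p | C p /\ enorm (u - p) = dist C u].

Definition argmin {T : Type} {R : realType} (D : set T) (f : T -> R) : set T :=
  [set z | D z /\ forall w, D w -> f z <= f w].

Definition indicator {R : realType} {T : Type} (D : set T) (u : T) : \bar R :=
  if u \in D then 0%E else +oo%E.

(** Frechet (regular) subdifferential at a point of the domain:
      liminf_{z -> x, z <> x} (f z - f x - <v, z - x>) / ||z - x|| >= 0. *)
Definition frechet_subdiff {R : realType} {n : nat} (f : 'rV[R]_n -> \bar R)
    (x : 'rV[R]_n) : set 'rV[R]_n :=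
  [set v | f x \is a fin_num /\
    (0 <= limf_einf
       (fun z => (f z - f x - (dotv v (z - x))%:E) * ((enorm (z - x))^-1)%:E)
       x^')%E].

Definition limiting_subdiff {R : realType} {n : nat} (f : 'rV[R]_n -> \bar R)
    (x : 'rV[R]_n) : set 'rV[R]_n :=
  [set v | f x \is a fin_num /\
    exists (xk vk : nat -> 'rV[R]_n),
      [/\ xk k @[k --> \oo] --> x,
          f (xk k) @[k --> \oo] --> f x,
          vk k @[k --> \oo] --> v &
          forall k, frechet_subdiff f (xk k) (vk k)]].

Definition normal_cone {R : realType} {n : nat} (D : set 'rV[R]_n)
    (x : 'rV[R]_n) : set 'rV[R]_n :=
  limiting_subdiff (indicator D) x.

(** Stationary point of  min_{u in D} (1/2) d_C(u)^2,  where the gradient of the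
    objective at [z] is [z - proj C z]. *)
Definition stationary {R : realType} {n : nat} (C D : set 'rV[R]_n)
    (z : 'rV[R]_n) : Prop :=
  D z /\ [set z - proj C z + w | w in normal_cone D z] 0.

(** The values [y 0] and [z 0] play no role: the iterates are
    [(y t, z t, x t)] for [t >= 1], together with the initial point [x 0]. *)
Definition DR_sequence {R : realType} {n : nat} (C D : set 'rV[R]_n) (gamma : R)
    (x0 : 'rV[R]_n) (y z x : nat -> 'rV[R]_n) : Prop :=
  x 0%N = x0 /\
  forall t : nat,
    [/\ y t.+1 = (1 + gamma)^-1 *: (x t + gamma *: proj C (x t)),
        argmin D (fun w => enorm (2 *: y t.+1 - x t - w) ^+ 2) (z t.+1) &
        x t.+1 = x t + (z t.+1 - y t.+1)].

(* Main.v *)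
Require Import Defs.
From mathcomp Require Import all_boot all_order all_algebra.
From mathcomp Require Import all_classical all_reals all_analysis.
From mathcomp Require Import ring lra.

(** Write [p t] for the projection of [x t] onto [C]. Since [y t.+1] lies on
    the segment from [x t] to [p t], the point [p t] is also the projection of
    [y t.+1], and [x t = (1 + g) y t.+1 - g p t]. Eliminating [x] this way,
    the iteration becomes a recursion on the triples [(y, p, z)], and the
    Douglas-Rachford merit function takes, up to the factor [2 g], the
    explicit nonnegative form
      [g |z - p|^2 + (1 - g) |z - y|^2]    ([merit]).

    Everything rests on one inequality ([merit_decrease]): a step lowers the
    merit by at least [|z - y|^2 / 4]. It follows from an algebraic identity
    that writes the surplus as a nonnegative combination of squares, of the
    optimality of the new [z] among the points of [D] (tested against the old
    one), and of the two variational inequalities saying that the old and new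
    [p] are projections onto the convex set [C]. The combination has
    nonnegative coefficients as soon as [g < 1 / 2], which follows from
    [g < sqrt (3 / 2) - 1].

    Consequences. The merit is nonincreasing and bounded below, so its
    decrements tend to 0 and hence so does the residual
    [z t.+1 - y t.+1 = x t.+1 - x t] ([DR_residual_cvg0]). The merit bounds [z - p] and [z - y]; if
    [C] is compact then [p] is bounded, if [D] is compact then [z] is bounded,
    and either way all the iterates are ([DR_bounded]). Finally [z t.+1] is a
    nearest point of [D] to the reflected point [a t = 2 y t.+1 - x t], so
    [(a t - z t.+1) / g] is a proximal, hence Frechet, normal to [D] at [z t.+1];
    it equals [p t - y t.+1 - (z t.+1 - y t.+1) / g], which tends to
    [proj C zstar - zstar] along a subsequence, because projections onto [C] are
    nonexpansive. So this limit is a limiting normal to [D] at [zstar], which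
    is the stationarity condition ([DR_cluster_stationary]). *)

Set Implicit Arguments.
Unset Strict Implicit.
Unset Printing Implicit Defensive.

Import Order.TTheory GRing.Theory Num.Theory.
Import numFieldNormedType.Exports.

Local Open Scope classical_set_scope.
Local Open Scope ring_scope.

(** * The Euclidean inner product and norm *)

Lemma dotv_ge0 (R : realType) (n : nat) (u : 'rV[R]_n) : 0 <= dotv u u.
Proof. by apply: sumr_ge0 => i _; rewrite -expr2 sqr_ge0. Qed.

Lemma enorm_ge0 (R : realType) (n : nat) (u : 'rV[R]_n) : 0 <= enorm u.
Proof. exact: sqrtr_ge0. Qed.

Lemma enorm_sqr (R : realType) (n : nat) (u : 'rV[R]_n) :
  enorm u ^+ 2 = dotv u u.
Proof. by rewrite sqr_sqrtr ?dotv_ge0. Qed.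

Lemma dotvC (R : realType) (n : nat) (u v : 'rV[R]_n) : dotv u v = dotv v u.
Proof. by apply: eq_bigr => i _; rewrite mulrC. Qed.

Lemma dotvZl (R : realType) (n : nat) (k : R) (u v : 'rV[R]_n) :
  dotv (k *: u) v = k * dotv u v.
Proof.
by rewrite /dotv mulr_sumr; apply: eq_bigr => i _; rewrite mxE mulrA.
Qed.

Lemma dotvDl (R : realType) (n : nat) (u v w : 'rV[R]_n) :
  dotv (u + v) w = dotv u w + dotv v w.
Proof.
by rewrite /dotv -big_split; apply: eq_bigr => i _; rewrite !mxE mulrDl.
Qed.

Lemma dotvZr (R : realType) (n : nat) (k : R) (u v : 'rV[R]_n) :
  dotv u (k *: v) = k * dotv u v.
Proof. by rewrite dotvC dotvZl dotvC. Qed.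

Lemma dotvDr (R : realType) (n : nat) (u v w : 'rV[R]_n) :
  dotv u (v + w) = dotv u v + dotv u w.
Proof. by rewrite dotvC dotvDl dotvC [dotv w u]dotvC. Qed.

Lemma dotv_sqrB (R : realType) (n : nat) (u v : 'rV[R]_n) :
  dotv (u - v) (u - v) = dotv u u - 2 * dotv u v + dotv v v.
Proof.
rewrite -scaleN1r !(dotvDl, dotvDr, dotvZl, dotvZr) [dotv v u]dotvC.
by ring.
Qed.

(** The topology and boundedness are those of the max norm; this comparison
    transfers Euclidean estimates to it. *)
Lemma mxnorm_sqr_le (R : realType) (n : nat) (u : 'rV[R]_n) :
  `|u| ^+ 2 <= dotv u u.
Proof.
have [u0|/mx_norm_neq0[[i j] ui]] := eqVneq (mx_norm u) 0.
  by rewrite /Num.norm /= u0 expr0n /= dotv_ge0.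
rewrite /Num.norm /= ui /= [i]ord1 -normrX ger0_norm ?sqr_ge0//.
rewrite /dotv (bigD1 j)//= -expr2 lerDl sumr_ge0// => k _.
by rewrite -expr2 sqr_ge0.
Qed.

Lemma dotv_continuous (R : realType) (n : nat) :
  continuous (fun u : 'rV[R]_n => dotv u u).
Proof.
move=> u; apply: (@cvg_big _ _ +%R 0).
- exact: add_continuous.
- exact: nbhs_filter.
- move=> i _; have cu := @coord_continuous R 1 n ord0 i u.
  by apply: cvgM; first exact: nbhs_filter.
Qed.

Lemma enorm_continuous (R : realType) (n : nat) :
  continuous (@enorm R n).
Proof.
move=> u; exact: (continuous_comp (@dotv_continuous R n u)
  (@sqrt_continuous R (dotv u u))).
Qed.

Lemma cvg_enorm (R : realType) (n : nat) (T : Type) (F : set_system T)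
    (FF : Filter F) (f : T -> 'rV[R]_n) (l : 'rV[R]_n) :
  f @ F --> l -> enorm (f x) @[x --> F] --> enorm l.
Proof. by apply: continuous_cvg; exact: enorm_continuous. Qed.

Lemma enorm0 (R : realType) (n : nat) : enorm (0 : 'rV[R]_n) = 0.
Proof.
by rewrite /enorm /dotv big1 ?sqrtr0// => i _; rewrite mxE mul0r.
Qed.

Lemma mxnorm_le_enorm (R : realType) (n : nat) (u : 'rV[R]_n) :
  `|u| <= enorm u.
Proof.
by rewrite -ler_sqr ?nnegrE ?enorm_ge0// enorm_sqr mxnorm_sqr_le.
Qed.

Lemma enorm_gt0 (R : realType) (n : nat) (u : 'rV[R]_n) :
  u != 0 -> 0 < enorm u.
Proof.
by rewrite -normr_gt0 => /lt_le_trans; apply; exact: mxnorm_le_enorm.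
Qed.

(** * Projection onto a closed convex set *)

(** The variational characterization of the projection. It is preserved when
    the projected point moves along its segment and it yields
    nonexpansiveness, two things that are awkward to read off from the minimal
    distance. *)
Definition is_projection {R : realType} {n : nat} (C : set 'rV[R]_n)
    (u p : 'rV[R]_n) : Prop :=
  C p /\ forall c, C c -> dotv (u - p) (c - p) <= 0.

Lemma dist_le (R : realType) (n : nat) (C : set 'rV[R]_n) (u c : 'rV[R]_n) :
  C c -> dist C u <= enorm (u - c).
Proof.
move=> Cc; apply: ge_inf; last by exists c.
by exists 0 => _ [d _ <-]; exact: enorm_ge0.
Qed.

(** Only the points of [C] that are no farther from [u] than a fixed one
    matter, and these form a compact set. *)
Lemma dist_attained (R : realType) (n : nat) (C : set 'rV[R]_n)
    (u : 'rV[R]_n) :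
  C !=set0 -> closed C -> exists p, C p /\ enorm (u - p) = dist C u.
Proof.
move=> [c0 Cc0] Cclosed.
have cont : continuous (fun c : 'rV[R]_n => enorm (u - c)).
  move=> c; apply: (@cvg_enorm R n _ _ (nbhs_filter c)).
  by apply: cvgB; [exact: cvg_cst|exact: cvg_id].
pose K := C `&`
  (fun c : 'rV[R]_n => enorm (u - c)) @^-1` [set r | r <= enorm (u - c0)].
have K0 : K c0 by split => //=.
have Kclosed : closed K.
  apply: closedI => //; apply: preimage_closed (@closed_le R _).
  by move=> c _; exact: cont.
have Kbounded : bounded_set K.
  exists (`|u| + enorm (u - c0)); split; first exact: num_real.
  move=> M ltM c [_ /= cle]; apply/ltW/(le_lt_trans _ ltM).
  have -> : c = u - (u - c) by rewrite subKr.
  rewrite (le_trans (ler_normB _ _))// lerD2l (le_trans _ cle)//.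
  exact: mxnorm_le_enorm.
have [|p] := @EVT_min_rV R n (fun c => enorm (u - c)) K (ex_intro _ c0 K0)
  (bounded_closed_compact Kbounded Kclosed).
  exact: continuous_subspaceT.
rewrite inE => -[Cp /= ple] pmin; exists p; split => //.
apply/le_anti; rewrite dist_le// andbT; apply: lb_le_inf.
  by exists (enorm (u - c0)), c0.
move=> _ [c Cc <-]; have [cle|/ltW] := leP (enorm (u - c)) (enorm (u - c0)).
  by apply: pmin; rewrite inE.
exact: le_trans.
Qed.

(** If [d = <u - p, c - p>] were positive, then moving from [p] towards [c] by
    the fraction [s] would change the squared distance to [u] by [s (s N - 2
    d)], with [N = |c - p|^2], which is negative for small [s]. *)
Lemma projP (R : realType) (n : nat) (C : set 'rV[R]_n) (u : 'rV[R]_n) :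
  C !=set0 -> closed C -> @convex_set R 'rV[R]_n C ->
  is_projection C u (Defs.proj C u).
Proof.
move=> C0 Cclosed Cconvex.
have [Cp pE] := @xgetPex _ (0 : 'rV[R]_n) _ (dist_attained u C0 Cclosed).
rewrite -/(Defs.proj C u) in Cp pE; set p := Defs.proj C u in Cp pE *.
split => // c Cc; rewrite leNgt; apply/negP.
set d := dotv (u - p) (c - p) => d0.
set N := dotv (c - p) (c - p); have N0 : 0 <= N by exact: dotv_ge0.
have dN0 : 0 < d + N by rewrite ltr_wpDr.
(* This [s] lies in ]0, 1], also when [N = 0], and satisfies [s N <= d]. *)
pose s := d / (d + N).
have s0 : 0 < s by rewrite divr_gt0.
have s1 : s <= 1 by rewrite ler_pdivrMr// mul1r lerDl.
have := Cconvex c p (Itv01 (ltW s0) s1); rewrite !inE => /(_ Cc Cp).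
have -> : conv (Itv01 (ltW s0) s1) (c : convex_lmodType 'rV[R]_n) p =
    p + s *: (c - p).
  by apply/rowP => i; rewrite !mxE /= /unstable.onem; ring.
move=> /(dist_le u); rewrite -pE -ler_sqr ?nnegrE ?enorm_ge0//.
rewrite !enorm_sqr opprD addrA [leRHS]dotv_sqrB !(dotvZl, dotvZr) -/d -/N.
have sdN : s * (d + N) = d by rewrite /s divfK// gt_eqF.
nra.
Qed.

(** Expanding [u - v = (p - q) - ((v - q) - (u - p))], the cross term has a
    sign by the two variational inequalities. *)
Lemma is_projection_nonexpansive (R : realType) (n : nat) (C : set 'rV[R]_n)
    (u v p q : 'rV[R]_n) :
  is_projection C u p -> is_projection C v q -> enorm (p - q) <= enorm (u - v).
Proof.
move=> [Cp up] [Cq vq]; rewrite -ler_sqr ?nnegrE ?enorm_ge0// !enorm_sqr.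
have -> : u - v = (p - q) - ((v - q) - (u - p)).
  by apply/rowP => i; rewrite !mxE; ring.
rewrite [leRHS]dotv_sqrB.
have := up q Cq; have := vq p Cp; have := dotv_ge0 (v - q - (u - p)).
have -> : dotv (p - q) (v - q - (u - p)) =
    dotv (v - q) (p - q) + dotv (u - p) (q - p).
  by rewrite /dotv -big_split; apply: eq_bigr => i _; rewrite /= !mxE; ring.
lra.
Qed.

Lemma is_projection_segment (R : realType) (n : nat) (C : set 'rV[R]_n)
    (u v p : 'rV[R]_n) (k : R) :
  0 <= k -> v - p = k *: (u - p) -> is_projection C u p -> is_projection C v p.
Proof.
move=> k0 vE [Cp up]; split => // c Cc.
by rewrite vE dotvZl mulr_ge0_le0// up.
Qed.

(** * Normals to the constraint set *)

(** Nearest points give normals: minimality of [z] over [D] reads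
    [2 <a - z, w - z> <= |w - z|^2] for [w] in [D], a bound of second order in
    [w - z], so dividing by [|w - z|] leaves a quantity that vanishes in the
    limit. *)
Lemma proximal_normal (R : realType) (n : nat) (D : set 'rV[R]_n)
    (a z : 'rV[R]_n) (k : R) :
  0 <= k -> argmin D (fun w => enorm (a - w) ^+ 2) z ->
  frechet_subdiff (indicator D) z (k *: (a - z)).
Proof.
move=> k0 [Dz zmin]; rewrite /frechet_subdiff /= {1 3}/indicator mem_set//.
split => //; rewrite limf_einfE; apply/lee_subgt0Pr => e e0.
rewrite sub0e.
have V : z^' [set w | k * enorm (w - z) < e /\ w != z].
  rewrite /dnbhs /within /=.
  have : (fun w : 'rV[R]_n => k * enorm (w - z)) @ nbhs z --> k * enorm (z - z).
    apply: cvgM; first exact: cvg_cst.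
    apply: (@cvg_enorm R n _ _ (nbhs_filter z)).
    by apply: cvgB; [exact: cvg_id|exact: cvg_cst].
  rewrite subrr enorm0 mulr0 => /cvgr_lt /(_ e e0).
  apply: filterS => w /= we wz.
  by split.
apply: (@le_trans _ _ (ereal_inf ((fun w => (indicator D w - 0 -
    (dotv (k *: (a - z)) (w - z))%:E) * ((enorm (w - z))^-1)%:E)%E @`
      [set w | k * enorm (w - z) < e /\ w != z]))); last first.
  by apply: ereal_sup_ubound; exists [set w | k * enorm (w - z) < e /\ w != z].
apply: le_ereal_inf_tmp => _ [w [we wz] <-].
have wz0 : 0 < enorm (w - z) by rewrite enorm_gt0// subr_eq0.
(* Outside [D] the difference quotient is infinite. *)
rewrite /indicator; have [wD|wD] := boolP (w \in D); last first.
  by rewrite /= gt0_mulye ?leey// lte_fin invr_gt0.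
rewrite -!EFinB -EFinM lee_fin ler_pdivlMr// !sub0r.
have := zmin w (set_mem wD); rewrite !enorm_sqr.
have -> : a - w = (a - z) - (w - z) by apply/rowP => i; rewrite !mxE; ring.
rewrite [leRHS]dotv_sqrB dotvZl -[dotv (w - z) _]enorm_sqr => h.
nra.
Qed.

(** Both sequences required by the limiting subdifferential are given by
    proximal normals; the indicator is constant on [D], which contains [l]
    since it is closed. *)
Lemma normal_cone_limit (R : realType) (n : nat) (D : set 'rV[R]_n)
    (a z v : nat -> 'rV[R]_n) (k : R) (l w : 'rV[R]_n) :
  0 <= k -> closed D ->
  (forall t, argmin D (fun u => enorm (a t - u) ^+ 2) (z t)) ->
  (forall t, v t = k *: (a t - z t)) ->
  z @ \oo --> l -> v @ \oo --> w -> normal_cone D l w.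
Proof.
move=> k0 Dclosed zmin vE zl vw.
have Dz t : D (z t) by have [] := zmin t.
have Dl : D l by apply: (closed_cvg D Dclosed _ _ zl); near=> t; exact: Dz.
have ind0 u : D u -> indicator D u = 0%E :> \bar R.
  by move=> Du; rewrite /indicator mem_set.
split; first by rewrite ind0.
exists z, v; split => //.
  rewrite ind0//; apply: cvg_near_cst; near=> t; rewrite ind0//; exact: Dz.
by move=> t; rewrite vE; exact: proximal_normal.
Unshelve. all: by end_near. Qed.

(** * The merit function *)

(** With [f] the function [d_C^2 / 2] and [p] the projection of [y] onto [C],
    this is [2 g] times [f y + <y - p, z - y> + |z - y|^2 / (2 g)], the
    Douglas-Rachford merit function at an iterate with [z] in [D]: the first
    two terms equal [(|z - p|^2 - |z - y|^2) / 2]. *)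
Definition merit {R : realType} {n : nat} (g : R) (y p z : 'rV[R]_n) : R :=
  g * dotv (z - p) (z - p) + (1 - g) * dotv (z - y) (z - y).

Lemma merit_ge0 (R : realType) (n : nat) (g : R) (y p z : 'rV[R]_n) :
  0 < g -> g < 1 -> 0 <= merit g y p z.
Proof.
by move=> g0 g1; rewrite addr_ge0// mulr_ge0 ?dotv_ge0 ?subr_ge0// ltW.
Qed.

(** The expression for [z] is what remains of [x' = x + (z - y)] once [x] and
    [x'] are written as [(1 + g) y - g p] and [(1 + g) y' - g p']. The point
    [r] is then [2 y' - x'], whose nearest point in [D] is [z']. *)
Lemma merit_decrease (R : realType) (n : nat) (g : R)
    (y p z y' p' z' : 'rV[R]_n) :
  0 < g -> g < 1 / 2 ->
  dotv (y - p) (p' - p) <= 0 -> dotv (y' - p') (p - p') <= 0 ->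
  z = y' + g *: ((y' - p') - (y - p)) ->
  let r := y' - g *: (y' - p') in
  dotv (r - z') (r - z') <= dotv (r - z) (r - z) ->
  merit g y' p' z' + dotv (z - y) (z - y) / 4 <= merit g y p z.
Proof.
move=> g0 g12 var var' zE r opt; rewrite -subr_ge0.
set dq := (y' - p') - (y - p).
(* Three sources: optimality of [z'] against [z], the two variational
   inequalities, and squares; [g < 1 / 2] makes all coefficients nonnegative. *)
have -> : merit g y p z - (merit g y' p' z' + dotv (z - y) (z - y) / 4) =
    (dotv (r - z) (r - z) - dotv (r - z') (r - z'))
    + ((2 * g + (g + g ^+ 2) / 2) * - dotv (y' - p') (p - p')
    + ((g + g ^+ 2) / 2 * - dotv (y - p) (p' - p)
    + ((g - 2 * g ^+ 2) * dotv dq dq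
    + ((3 - 2 * g - g ^+ 2) / 4 * dotv (y' - y) (y' - y)
    + (2 * g + g ^+ 2) / 4 * dotv (p' - p) (p' - p))))).
  rewrite /merit ![_ / 4]mulrC /dotv.
  rewrite !(mulr_sumr, =^~ sumrN, =^~ big_split)/=.
  by apply: eq_bigr => i _; rewrite zE /r /dq !mxE; field.
rewrite addr_ge0 ?subr_ge0// !addr_ge0// mulr_ge0 ?oppr_ge0 ?dotv_ge0//; nra.
Qed.

(** * Limits of sequences *)

Lemma cvg_of_enorm (R : realType) (n : nat) (T : Type) (F : set_system T)
    (FF : Filter F) (f : T -> 'rV[R]_n) (l : 'rV[R]_n) :
  enorm (f x - l) @[x --> F] --> (0 : R) -> f @ F --> l.
Proof.
move=> fl; apply/cvgrPdist_lt => e e0.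
have /(_ FF e e0) := cvgr_lt _ fl; apply: filterS => x.
by apply: le_lt_trans; rewrite distrC mxnorm_le_enorm.
Qed.

Lemma cvg_drop_to0 (R : realType) (m a : nat -> R) :
  (forall t, 0 <= m t) -> (forall t, 0 <= a t) ->
  (forall t, m t.+1 + a t <= m t) -> a @ \oo --> (0 : R).
Proof.
move=> m0 a0 dec.
have mle t : m t.+1 <= m t by rewrite (le_trans _ (dec t))// lerDl.
have mcvg : cvgn m.
  apply: nonincreasing_is_cvgn; first exact/nonincreasing_seqP.
  by exists 0 => _ [t _ <-].
apply: (@squeeze_cvgr _ _ eventually_filter R (fun=> 0)
  (fun t => m t - m t.+1)).
- by near=> t; rewrite a0 /= lerBrDl dec.
- exact: cvg_cst.
- rewrite -(subrr (limn m)); apply: cvgB => //.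
  by rewrite (cvg_shiftS m).
Unshelve. all: by end_near. Qed.

(** The limiting subdifferential is defined by sequences, so cluster points of
    the iteration are turned into limits along a selection of indices. *)
Lemma cluster_subsequence (R : realType) (V : pseudoMetricNormedZmodType R)
    (u : nat -> V) (l : V) :
  cluster (u @ \oo) l ->
  exists s : nat -> nat, s @ \oo --> \oo /\ u (s k) @[k --> \oo] --> l.
Proof.
move=> ul.
have near_l (k : nat) : exists t : nat, (k <= t)%N /\ `|l - u t| < k.+1%:R^-1.
  have tail : (u @ \oo) [set u t | t in [set t : nat | (k <= t)%N]].
    by exists k => // t /= kt; exists t.
  have k0 : 0 < k.+1%:R^-1 :> R by rewrite invr_gt0.
  have [_ [[t kt <-] ut]] := ul _ _ tail (nbhsx_ballx l _ k0).
  by exists t; split => //; move: ut; rewrite -ball_normE.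
have [s sP] := choice near_l; exists s; split.
  move=> A [N _ NA]; exists N => // k /= Nk; apply: NA => /=.
  exact: leq_trans Nk (sP k).1.
apply/cvgrPdist_lt => e e0.
have /cvgr_lt/(_ e e0) := @cvg_harmonic R.
by apply: filterS => k; apply: lt_trans; exact: (sP k).2.
Qed.

(** * The Douglas-Rachford iteration *)

Definition shadow {R : realType} {n : nat} (C : set 'rV[R]_n)
    (x : nat -> 'rV[R]_n) (t : nat) : 'rV[R]_n := Defs.proj C (x t).

Lemma DR_x_eq (R : realType) (n : nat) (C D : set 'rV[R]_n) (g : R)
    (x0 : 'rV[R]_n) (y z x : nat -> 'rV[R]_n) (t : nat) :
  0 < g -> DR_sequence C D g x0 y z x ->
  x t = (1 + g) *: y t.+1 - g *: shadow C x t.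
Proof.
move=> g0 [_ /(_ t)[-> _ _]].
by rewrite scalerA divff ?gt_eqF ?addr_gt0// scale1r addrK.
Qed.

(** [y t.+1] lies on the segment from [x t] to its projection. *)
Lemma DR_shadow (R : realType) (n : nat) (C D : set 'rV[R]_n) (g : R)
    (x0 : 'rV[R]_n) (y z x : nat -> 'rV[R]_n) (t : nat) :
  C !=set0 -> closed C -> @convex_set R 'rV[R]_n C -> 0 < g ->
  DR_sequence C D g x0 y z x -> is_projection C (y t.+1) (shadow C x t).
Proof.
move=> C0 Cclosed Cconvex g0 DR.
apply: (@is_projection_segment _ _ _ (x t) _ _ (1 + g)^-1); last exact: projP.
  by rewrite invr_ge0 addr_ge0// ltW.
rewrite (DR_x_eq t g0 DR).
by apply/rowP => i; rewrite !mxE; field; rewrite gt_eqF// addr_gt0.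
Qed.

Lemma DR_argmin (R : realType) (n : nat) (C D : set 'rV[R]_n) (g : R)
    (x0 : 'rV[R]_n) (y z x : nat -> 'rV[R]_n) (t : nat) :
  0 < g -> DR_sequence C D g x0 y z x ->
  argmin D (fun w => enorm (y t.+1 - g *: (y t.+1 - shadow C x t) - w) ^+ 2)
    (z t.+1).
Proof.
move=> g0 DR; have [_ /(_ t)[_ + _]] := DR.
have -> // : 2 *: y t.+1 - x t = y t.+1 - g *: (y t.+1 - shadow C x t).
rewrite (DR_x_eq t g0 DR).
by apply/rowP => i; rewrite !mxE; ring.
Qed.

Lemma DR_merit_decrease (R : realType) (n : nat) (C D : set 'rV[R]_n) (g : R)
    (x0 : 'rV[R]_n) (y z x : nat -> 'rV[R]_n) (t : nat) :
  C !=set0 -> closed C -> @convex_set R 'rV[R]_n C -> 0 < g -> g < 1 / 2 ->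
  DR_sequence C D g x0 y z x ->
  merit g (y t.+2) (shadow C x t.+1) (z t.+2)
    + enorm (z t.+1 - y t.+1) ^+ 2 / 4 <=
  merit g (y t.+1) (shadow C x t) (z t.+1).
Proof.
move=> C0 Cclosed Cconvex g0 g12 DR.
have [Cp var] := DR_shadow t C0 Cclosed Cconvex g0 DR.
have [Cp' var'] := DR_shadow t.+1 C0 Cclosed Cconvex g0 DR.
have [Dz _] := DR_argmin t g0 DR.
have [_ zmin] := DR_argmin t.+1 g0 DR.
rewrite enorm_sqr; apply: merit_decrease => //.
- exact: var.
- exact: var'.
- have [_ /(_ t)[_ _ xS]] := DR.
  have -> : z t.+1 = x t.+1 - x t + y t.+1.
    by rewrite xS [x t + _]addrC addrK subrK.
  rewrite (DR_x_eq t g0 DR) (DR_x_eq t.+1 g0 DR).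
  by apply/rowP => i; rewrite !mxE; ring.
- by rewrite -!enorm_sqr; exact: zmin.
Qed.

Lemma DR_residual_cvg0 (R : realType) (n : nat) (C D : set 'rV[R]_n) (g : R)
    (x0 : 'rV[R]_n) (y z x : nat -> 'rV[R]_n) :
  C !=set0 -> closed C -> @convex_set R 'rV[R]_n C -> 0 < g -> g < 1 / 2 ->
  DR_sequence C D g x0 y z x ->
  enorm (z t.+1 - y t.+1) @[t --> \oo] --> (0 : R).
Proof.
move=> C0 Cclosed Cconvex g0 g12 DR.
have sq : enorm (z t.+1 - y t.+1) ^+ 2 / 4 @[t --> \oo] --> (0 : R).
  apply: (@cvg_drop_to0 _ (fun t => merit g (y t.+1) (shadow C x t) (z t.+1))).
  - by move=> t; apply: merit_ge0; lra.
  - by move=> t; rewrite divr_ge0// sqr_ge0.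
  - by move=> t; exact: DR_merit_decrease DR.
have : Num.sqrt (4 * (enorm (z t.+1 - y t.+1) ^+ 2 / 4)) @[t --> \oo] -->
    Num.sqrt (4 * 0 : R).
  by apply: continuous_cvg; [exact: sqrt_continuous|exact: cvgMr].
rewrite mulr0 sqrtr0; under eq_fun do
  rewrite mulrC divfK ?pnatr_eq0// sqrtr_sqr ger0_norm ?enorm_ge0//.
by [].
Qed.

(** The merit controls [z - p] and [z - y], so that a bound on one of [p], [z]
    is a bound on [y], [z] and [p], hence on [x], which is a combination of
    [y] and [p]. *)
Lemma DR_bounded (R : realType) (n : nat) (C D : set 'rV[R]_n) (g : R)
    (x0 : 'rV[R]_n) (y z x : nat -> 'rV[R]_n) :
  C !=set0 -> closed C -> @convex_set R 'rV[R]_n C -> compact C \/ compact D ->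
  0 < g -> g < 1 / 2 -> DR_sequence C D g x0 y z x ->
  bounded_fun (fun t : nat => (y t.+1, z t.+1, x t.+1)).
Proof.
move=> C0 Cclosed Cconvex CD g0 g12 DR.
pose m t := merit g (y t.+1) (shadow C x t) (z t.+1).
have m_le t : m t <= m 0%N.
  elim: t => // t; apply: le_trans.
  have := DR_merit_decrease t C0 Cclosed Cconvex g0 g12 DR.
  by apply: le_trans; rewrite lerDl divr_ge0// sqr_ge0.
have norm_le (u : 'rV[R]_n) (k : R) : 0 < k -> k * dotv u u <= m 0%N ->
    `|u| <= 1 + m 0%N / k.
  move=> k0 ku; have : `|u| ^+ 2 <= m 0%N / k.
    by rewrite (le_trans (mxnorm_sqr_le _))// ler_pdivlMr// mulrC.
  by nra.
have zp t : `|z t.+1 - shadow C x t| <= 1 + m 0%N / g.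
  apply: norm_le => //; apply: le_trans (m_le t).
  by rewrite lerDl mulr_ge0 ?dotv_ge0//; lra.
have zy t : `|z t.+1 - y t.+1| <= 1 + m 0%N / (1 - g).
  apply: norm_le; first lra; apply: le_trans (m_le t).
  by rewrite lerDr mulr_ge0 ?dotv_ge0//; lra.
have [B zB] : exists B, forall t, `|z t.+1| <= B.
  case: CD => /compact_bounded[B [_ HB]].
    exists ((1 + m 0%N / g) + (B + 1)) => t.
    rewrite -(subrK (shadow C x t) (z t.+1)) (le_trans (ler_normD _ _))//.
    apply: lerD => //; apply: HB; first by rewrite ltrDl.
    by have [] := DR_shadow t C0 Cclosed Cconvex g0 DR.
  exists (B + 1) => t; apply: HB; first by rewrite ltrDl.
  by have [] := DR_argmin t g0 DR.
have yB t : `|y t.+1| <= B + (1 + m 0%N / (1 - g)).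
  rewrite -(subKr (z t.+1) (y t.+1)) (le_trans (ler_normB _ _))//.
  exact: lerD.
have pB t : `|shadow C x t| <= B + (1 + m 0%N / g).
  rewrite -(subKr (z t.+1) (shadow C x t)) (le_trans (ler_normB _ _))//.
  exact: lerD.
pose By := B + (1 + m 0%N / (1 - g)); pose Bp := B + (1 + m 0%N / g).
have xB t : `|x t| <= (1 + g) * By + g * Bp.
  rewrite (DR_x_eq t g0 DR) (le_trans (ler_normB _ _))//.
  rewrite !normrZ !gtr0_norm ?addr_gt0//.
  by apply: lerD; rewrite ler_pM2l// addr_gt0.
exists (Num.max (Num.max By B) ((1 + g) * By + g * Bp)).
split; first exact: num_real.
move=> M /ltW BM t _ /=; apply: le_trans BM.
by rewrite !prod_normE /= !ge_max !le_max yB zB xB !orbT.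
Qed.

Lemma DR_cluster_stationary (R : realType) (n : nat) (C D : set 'rV[R]_n)
    (g : R) (x0 : 'rV[R]_n) (y z x : nat -> 'rV[R]_n)
    (ystar zstar xstar : 'rV[R]_n) :
  C !=set0 -> closed C -> @convex_set R 'rV[R]_n C -> closed D ->
  0 < g -> g < 1 / 2 -> DR_sequence C D g x0 y z x ->
  cluster ((y t.+1, z t.+1, x t.+1) @[t --> \oo]) (ystar, zstar, xstar) ->
  zstar = ystar /\ stationary C D zstar.
Proof.
move=> C0 Cclosed Cconvex Dclosed g0 g12 DR.
move=> /cluster_subsequence[s [s_oo u_cvg]].
have y_cvg : y (s k).+1 @[k --> \oo] --> ystar.
  exact: (cvg_comp _ _ (cvg_comp _ _ u_cvg cvg_fst) cvg_fst).
have z_cvg : z (s k).+1 @[k --> \oo] --> zstar.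
  exact: (cvg_comp _ _ (cvg_comp _ _ u_cvg cvg_fst) cvg_snd).
have zy_cvg : z (s k).+1 - y (s k).+1 @[k --> \oo] --> (0 : 'rV[R]_n).
  apply: cvg_of_enorm; under eq_fun do rewrite subr0.
  exact: (cvg_comp _ _ s_oo
    (DR_residual_cvg0 C0 Cclosed Cconvex g0 g12 DR)).
have zyE : zstar = ystar.
  apply/eqP; rewrite -subr_eq0; apply/eqP.
  exact: (cvg_unique (@norm_hausdorff _ _) (cvgB z_cvg y_cvg) zy_cvg).
split => //; split.
  apply: (closed_cvg D Dclosed _ _ z_cvg); near=> k.
  by have [] := DR_argmin (s k) g0 DR.
have p_cvg : shadow C x (s k) @[k --> \oo] --> Defs.proj C zstar.
  apply: cvg_of_enorm.
  apply: (@squeeze_cvgr _ _ _ R (fun=> 0)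
    (fun k => enorm (y (s k).+1 - zstar))).
  - near=> k; rewrite enorm_ge0 /=; apply: (@is_projection_nonexpansive _ _ C).
      exact: (DR_shadow (s k) C0 Cclosed Cconvex g0 DR).
    exact: projP.
  - exact: cvg_cst.
  - rewrite -(enorm0 R n) -(subrr zstar); apply: cvg_enorm; apply: cvgB.
      by rewrite zyE.
    exact: cvg_cst.
exists (Defs.proj C zstar - zstar); last by rewrite addrC subrKA subrr.
pose a k := y (s k).+1 - g *: (y (s k).+1 - shadow C x (s k)).
apply: (@normal_cone_limit _ _ _ a (fun k => z (s k).+1)
  (fun k => g^-1 *: (a k - z (s k).+1)) g^-1) => //.
- by rewrite invr_ge0 ltW.
- by move=> k; exact: DR_argmin DR.
have -> : Defs.proj C zstar - zstar =
    Defs.proj C zstar - ystar - g^-1 *: 0 by rewrite scaler0 subr0 zyE.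
(* [a - z = g (p - y) - (z - y)]: the residual, even divided by [g], vanishes
   in the limit. *)
have -> : (fun k => g^-1 *: (a k - z (s k).+1)) =
    (fun k => shadow C x (s k) - y (s k).+1
      - g^-1 *: (z (s k).+1 - y (s k).+1)).
  apply/funext => k; apply/rowP => i; rewrite !mxE; field.
  by rewrite gt_eqF.
by apply: cvgB; [exact: cvgB|exact: cvgZr].
Unshelve. all: by end_near. Qed.

Unset Implicit Arguments.

Theorem theorem5 (R : realType) (n : nat) (C D : set 'rV[R]_n)
    (C_nonempty : C !=set0) (C_closed : closed C)
    (C_convex : @convex_set R 'rV[R]_n C)
    (D_nonempty : D !=set0) (D_closed : closed D)
    (CD_compact : compact C \/ compact D)
    (gamma : R) (gamma_gt0 : 0 < gamma) (gamma_lt : gamma < Num.sqrt (3 / 2) - 1)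
    (x0 : 'rV[R]_n) (y z x : nat -> 'rV[R]_n)
    (yzx_DR : DR_sequence C D gamma x0 y z x) :
  [/\ bounded_fun (fun t : nat => (y t.+1, z t.+1, x t.+1)),
      forall ystar zstar xstar : 'rV[R]_n,
        cluster ((y t.+1, z t.+1, x t.+1) @[t --> \oo]) (ystar, zstar, xstar) ->
        zstar = ystar /\ stationary C D zstar,
      enorm (x t.+1 - x t) @[t --> \oo] --> (0 : R) &
      enorm (z t.+1 - y t.+1) @[t --> \oo] --> (0 : R)].
Proof.
(* [sqrt (3 / 2) < 3 / 2]. *)
have gamma_lt_half : gamma < 1 / 2.
  have sq : Num.sqrt (3 / 2 : R) ^+ 2 = 3 / 2 by rewrite sqr_sqrtr//; lra.
  by nra.
have residual := DR_residual_cvg0 C_nonempty C_closed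
  C_convex gamma_gt0 gamma_lt_half yzx_DR.
split => //.
- exact: DR_bounded CD_compact _ _ yzx_DR.
- move=> ystar zstar xstar; exact: DR_cluster_stationary yzx_DR.
- have xS t : x t.+1 - x t = z t.+1 - y t.+1.
    by have [_ /(_ t)[_ _ ->]] := yzx_DR; rewrite addrC addKr.
  by under eq_fun do rewrite xS.
Qed.
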